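(* Let $D$ be a bounded convex domain in a Banach space $V$, and let $(D,d)$ be a $(1,\kappa)$-quasi-geodesic metric space (for some $\kappa\ge0$), whose topology coincides with the norm topology, satisfying Axiom $1'$, Axiom $5'$ and the condition $$d(sx+(1-s)y,z)\le\max\{d(x,z),d(y,z)\}\quad\text{for all }x,y,z\in D,\ s\in[0,1].$$ If $S=\{f_t:D\to D\}_{t\ge0}$ is a one-parameter continuous semigroup of nonexpansive mappings without bounded orbits, and there exists $t_0>0$ such that $f_{t_0}:D\to D$ is a compact mapping, then there exists $\xi\in\partial D$ such that $$\Omega_S\subset\mathrm{ch}(\mathrm{ch}(\xi)).$$
   Context: $\overline{D}$ is the closure of $D$ in the norm topology and $\partial D=\overline{D}\setminus D$. $(D,d)$ is $(1,\kappa)$-quasi-geodesic if every pair of points of $D$ can be connected by a curve $\gamma:[a,b]\to D$ with $|t_1-t_2|-\kappa\le d(\gamma(t_1),\gamma(t_2))\le|t_1-t_2|+\kappa$ for all $t_1,t_2\in[a,b]$. Axiom $1'$ (here with ambient space $(\overline{D},\|\cdot\|)$): the topology of $d$ on $D$ coincides with the norm topology, and for any $w\in D$, if $\{x_n\}\subset D$ converges in norm to a point of $\partial D$, then $d(x_n,w)\to\infty$. Axiom $5'$ (here with respect to the norm): if $\{x_n\},\{y_n\}$ are sequences in $D$ and $d(x_n,y_n)\to0$, then $\|x_n-y_n\|\to0$. A map $f:D\to D$ is nonexpansive if $d(f(x),f(y))\le d(x,y)$ for all $x,y\in D$; it is compact if the norm closure of $f(D)$ is compact in $\overline{D}$. A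 family $S=\{f_t:D\to D\}_{t\ge0}$ is a one-parameter continuous semigroup if $f_{s+t}=f_t\circ f_s$ for all $s,t\ge0$ and $\lim_{t\to0^+}f_t(y)=f_0(y)=y$ for every $y\in D$. ''Without bounded orbits'' means that no orbit $\{f_t(y):t\ge0\}$, $y\in D$, is $d$-bounded. Attractor of $S$: $\Omega_S=\bigcup_{x\in D}\omega_S(x)$, where $\omega_S(x)=\{y\in\overline{D}:\|f_{t_n}(x)-y\|\to0\text{ for some increasing sequence }t_n\to\infty\}$. For $\xi\in\partial D$ and $F\subset\partial D$: $\mathrm{ch}(\xi)=\{x\in\partial D:[x,\xi]\subset\partial D\}$ and $\mathrm{ch}(F)=\bigcup_{\zeta\in F}\mathrm{ch}(\zeta)$, where $[x,\xi]$ is the closed line segment. *)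

(* Defs.v *)
From HB Require Import structures.
From mathcomp Require Export all_boot all_order all_algebra.
From mathcomp Require Export all_classical all_reals all_analysis.

#[export] Set Implicit Arguments.
#[export] Unset Strict Implicit.
#[export] Unset Printing Implicit Defensive.

Export Order.TTheory GRing.Theory Num.Theory.
Export numFieldNormedType.Exports.

Local Open Scope classical_set_scope.
Local Open Scope ring_scope.

(* A set D of V is studied with a second metric d.  Functions "on D" (d itself,
   self-maps of D) are total functions on V of which only the restriction to D
   is ever used; likewise f t is only used for 0 <= t. *)

Definition is_domain (T : topologicalType) (D : set T) : Prop :=
  [/\ open D, D !=set0 & connected D].

Definition norm_boundary (T : topologicalType) (D : set T) : set T :=
  closure D `\` D.

Definition is_metric_on (R : realType) (T : Type) (D : set T)
    (d : T -> T -> R) : Prop :=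
  [/\ forall x y, D x -> D y -> 0 <= d x y,
      forall x y, D x -> D y -> (d x y = 0 <-> x = y),
      forall x y, D x -> D y -> d x y = d y x &
      forall x y z, D x -> D y -> D z -> d x z <= d x y + d y z].

Definition metric_open (R : realType) (T : Type) (D : set T)
    (d : T -> T -> R) (A : set T) : Prop :=
  A `<=` D /\
  forall x, A x -> exists2 e, 0 < e & forall y, D y -> d x y < e -> A y.

Definition same_topology (R : realType) (T : topologicalType) (D : set T)
    (d : T -> T -> R) : Prop :=
  forall A : set T,
    metric_open D d A <-> (exists2 U : set T, open U & A = D `&` U).

Definition metric_bounded (R : realType) (T : Type) (D : set T)
    (d : T -> T -> R) (A : set T) : Prop :=
  exists w r, D w /\ forall z, A z -> d w z <= r.

(* Continuity of gamma is expressed in the topology of T; it is continuity for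
   d as soon as same_topology D d holds. *)
Definition quasi_geodesic (R : realType) (T : topologicalType) (D : set T)
    (d : T -> T -> R) (kappa : R) : Prop :=
  forall x y, D x -> D y ->
  exists (a b : R) (gamma : R -> T),
    [/\ a <= b,
        {within `[a, b], continuous gamma},
        (forall t, t \in `[a, b] -> D (gamma t)),
        gamma a = x /\ gamma b = y &
        forall t1 t2, t1 \in `[a, b] -> t2 \in `[a, b] ->
          `|t1 - t2| - kappa <= d (gamma t1) (gamma t2)
          /\ d (gamma t1) (gamma t2) <= `|t1 - t2| + kappa].

Definition axiom1' (R : realType) (T : topologicalType) (D : set T)
    (d : T -> T -> R) : Prop :=
  same_topology D d /\
  forall (w : T) (x_ : nat -> T) (p : T),
    D w -> (forall n, D (x_ n)) -> norm_boundary D p ->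
    x_ @ \oo --> p -> d (x_ n) w @[n --> \oo] --> +oo.

Definition axiom5' (R : realType) (V : normedModType R) (D : set V)
    (d : V -> V -> R) : Prop :=
  forall x_ y_ : nat -> V,
    (forall n, D (x_ n)) -> (forall n, D (y_ n)) ->
    d (x_ n) (y_ n) @[n --> \oo] --> (0 : R) ->
    `|x_ n - y_ n| @[n --> \oo] --> (0 : R).

Definition max_convex (R : realType) (V : lmodType R) (D : set V)
    (d : V -> V -> R) : Prop :=
  forall (x y z : V) (s : R), D x -> D y -> D z -> 0 <= s <= 1 ->
    d (s *: x + (1 - s) *: y) z <= Num.max (d x z) (d y z).

Definition nonexpansive (R : realType) (T : Type) (D : set T)
    (d : T -> T -> R) (f : T -> T) : Prop :=
  forall x y, D x -> D y -> d (f x) (f y) <= d x y.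

Definition compact_map (T : topologicalType) (D : set T) (f : T -> T) : Prop :=
  compact (closure (f @` D)).

Definition continuous_semigroup (R : realType) (T : topologicalType)
    (D : set T) (f : R -> T -> T) : Prop :=
  [/\ forall t x, 0 <= t -> D x -> D (f t x),
      forall s t x, 0 <= s -> 0 <= t -> D x -> f (s + t) x = f t (f s x) &
      forall y, D y -> f 0 y = y /\ f t y @[t --> 0^'+] --> y].

Definition semigroup_orbit (R : realType) (T : Type) (f : R -> T -> T)
    (y : T) : set T :=
  [set f t y | t in [set t | 0 <= t]].

Definition without_bounded_orbits (R : realType) (T : Type) (D : set T)
    (d : T -> T -> R) (f : R -> T -> T) : Prop :=
  forall y, D y -> ~ metric_bounded D d (semigroup_orbit f y).

Definition omega_limit (R : realType) (T : topologicalType) (D : set T)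
    (f : R -> T -> T) (x : T) : set T :=
  [set y | closure D y /\
    exists t_ : nat -> R,
      [/\ forall n, 0 <= t_ n, increasing_seq t_, t_ @ \oo --> +oo &
          f (t_ n) x @[n --> \oo] --> y]].

Definition attractor (R : realType) (T : topologicalType) (D : set T)
    (f : R -> T -> T) : set T :=
  \bigcup_(x in D) omega_limit D f x.

Definition segment (R : realType) (V : lmodType R) (x y : V) : set V :=
  [set s *: x + (1 - s) *: y | s in [set s : R | 0 <= s <= 1]].

Definition ch (R : realType) (V : normedModType R) (D : set V) (xi : V) :
    set V :=
  [set x | norm_boundary D x /\ segment x xi `<=` norm_boundary D].

Definition ch_set (R : realType) (V : normedModType R) (D F : set V) : set V :=
  \bigcup_(zeta in F) ch D zeta.

(* Main.v *)
Require Import Defs.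
From mathcomp Require Import lra.

(** Fix a base point y and let g(t) = d(y, f_t y), an unbounded function.  Pick
    times t_i at which g almost attains its running maximum, and let xi be a
    limit of x_i = f_{t_i} y.  If f_{tau_j} x --> zeta, then for t_i much larger
    than tau_j walk a distance nu along a quasi-geodesic from f_{tau_j - t0} x
    to f_{t_i - t0} y and apply f_{t0}: the point u reached satisfies
    d(u, f_{tau_j} x) <= nu + O(1), and, since t_i is nearly a record,
    d(u, x_i) <= d(y, x_i) - nu + O(1).  As f_{t0} is compact, u --> eta along a
    subsequence of nu --> oo.  By max-convexity, points of the segments
    [u, f_{tau_j} x] and [u, x_i] leave every d-bounded set, so that the
    segments [eta, zeta] and [eta, xi] lie in the boundary.  That zeta itself is
    in the boundary follows from Calka's theorem: an orbit that returns to a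
    bounded set at arbitrarily large times is bounded. *)

Local Open Scope classical_set_scope.
Local Open Scope ring_scope.

(** * Subsequences and limits *)

(** [phi] need not be monotone: [n <= phi n] is enough to transport limits at infinity. *)
Lemma compact_subsequence (R : realType) (V : normedModType R) (K : set V)
    (x_ : nat -> V) : compact K -> (forall n, K (x_ n)) ->
  exists (p : V) (phi : nat -> nat),
    (forall n, (n <= phi n)%N) /\ x_ (phi n) @[n --> \oo] --> p.
Proof.
move=> Kc Kx.
have Kx_near : \forall n \near \oo, K (x_ n) by exact: nearW.
have [p [_ clp]] := Kc (x_ @ \oo) _ Kx_near.
have /choice[phi phiP] (n : nat) :
    exists m, (n <= m)%N /\ `|p - x_ m| < n.+1%:R^-1.
  have [||_ [[m nm <-] pm]] :=
    clp [set x_ m | m in [set m | (n <= m)%N]] (ball p n.+1%:R^-1).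
  - by exists n => // m nm; exists m.
  - by apply: nbhsx_ballx; rewrite invr_gt0.
  - by exists m; split=> //; move: pm; rewrite -ball_normE.
exists p, phi; split=> [n|]; first exact: (phiP n).1.
apply/cvgrPdist_lt => e e0; near=> n.
apply: lt_trans (phiP n).2 _; near: n.
exact: near_infty_natSinv_lt (PosNum e0).
Unshelve. all: by end_near. Qed.

Lemma cvg_reindex (T : topologicalType) (x_ : nat -> T) (p : T)
    (phi : nat -> nat) : (forall n, (n <= phi n)%N) ->
  x_ @ \oo --> p -> x_ (phi n) @[n --> \oo] --> p.
Proof.
move=> phi_ge xp; apply: cvg_comp xp.
apply/cvgnyPge => N; near=> n; apply: leq_trans (phi_ge n); near: n.
exact: nbhs_infty_ge.
Unshelve. all: by end_near. Qed.

Lemma closure_lim (T : topologicalType) (A : set T) (x_ : nat -> T) p :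
  (forall n, A (x_ n)) -> x_ @ \oo --> p -> closure A p.
Proof.
move=> Ax xp; have Ax_near : \forall n \near \oo, closure A (x_ n).
  by apply: nearW => n; exact: subset_closure.
exact: (closed_cvg _ (@closed_closure _ A) Ax_near p xp).
Qed.

(** * The metric against the norm: limits in the boundary and quasi-geodesics *)

Section metric_on_domain.
Context {R : realType} {V : normedModType R} {D : set V} {d : V -> V -> R}.
Hypothesis d_metric : is_metric_on D d.

Lemma dist_ge0 x y : D x -> D y -> 0 <= d x y.
Proof. by case: d_metric => + _ _ _; apply. Qed.

Lemma distxx x : D x -> d x x = 0.
Proof. by case: d_metric => _ h _ _ Dx; apply/(h x x). Qed.

Lemma distC x y : D x -> D y -> d x y = d y x.
Proof. by case: d_metric => _ _ + _; apply. Qed.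

Lemma dist_triangle y x z : D x -> D y -> D z -> d x z <= d x y + d y z.
Proof. by case: d_metric => _ _ _ + Dx Dy Dz; apply. Qed.

Section topology.
Hypothesis d_topology : same_topology D d.

Lemma near_dist_lt p e : D p -> 0 < e -> \forall z \near p, D z -> d p z < e.
Proof.
move=> Dp e0; pose A := [set z | D z /\ d p z < e].
have : metric_open D d A.
  split=> [z []//|z [Dz pz]]; exists (e - d p z); first by rewrite subr_gt0.
  move=> y Dy zy; split=> //.
  by have := dist_triangle Dp Dz Dy; lra.
move=> /d_topology[U oU AU].
have Up : U p by have : A p by [split; rewrite ?distxx]; rewrite AU => -[].
have : nbhs p U by exact: open_nbhs_nbhs.
apply: filterS => z Uz Dz.
by have : A z by [rewrite AU]; case.
Qed.

Lemma cvg_dist_lt (x_ : nat -> V) p e :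
  D p -> (forall n, D (x_ n)) -> x_ @ \oo --> p -> 0 < e ->
  \forall n \near \oo, d p (x_ n) < e.
Proof.
move=> Dp Dx xp e0.
have near_p : \forall n \near \oo, D (x_ n) -> d p (x_ n) < e.
  exact: xp _ (near_dist_lt Dp e0).
by apply: filterS near_p => n; apply.
Qed.

(** A limit inside $D$ would also be a limit for [d], which would keep [d w (x_ n)] below
    [d w p + 1]. *)
Lemma norm_boundary_lim (w : V) (x_ : nat -> V) p :
  D w -> (forall n, D (x_ n)) -> x_ @ \oo --> p ->
  d w (x_ n) @[n --> \oo] --> +oo -> norm_boundary D p.
Proof.
move=> Dw Dx xp /cvgryPge x_unbounded; split.
  exact: closure_lim Dx xp.
move=> Dp.
have near1 := cvg_dist_lt Dp Dx xp ltr01.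
near \oo => n.
have : d w p + 1 <= d w (x_ n) by near: n; exact: x_unbounded.
have : d p (x_ n) < 1 by near: n.
by have := dist_triangle Dw Dp (Dx n); lra.
Unshelve. all: by end_near. Qed.

(** Max-convexity seen from [v_ n] gives $d(q_n,v_n)\le d(u_n,v_n)$ for $q_n$ on the segment, so
    $d(w,q_n)\ge d(w,v_n)-d(u_n,v_n)\ge n-C$. *)
Lemma segment_boundary (w : V) (u_ v_ : nat -> V) u v C :
  convex_set D -> max_convex D d ->
  D w -> (forall n, D (u_ n)) -> (forall n, D (v_ n)) ->
  u_ @ \oo --> u -> v_ @ \oo --> v ->
  (forall n, d (u_ n) (v_ n) + n%:R <= d w (v_ n) + C) ->
  segment u v `<=` norm_boundary D.
Proof.
move=> D_convex d_max Dw Du Dv uu vv far _ [s s01 <-].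
pose q_ n := s *: u_ n + (1 - s) *: v_ n.
have Dq n : D (q_ n).
  case/andP: (s01) => s0 s1.
  have := D_convex (u_ n) (v_ n) (Itv01 s0 s1).
  by rewrite !inE; apply.
apply: (@norm_boundary_lim w q_) => //.
  by apply: cvgD; apply: cvgZr.
apply/cvgryPge => A.
have : \forall n \near \oo, A + C <= n%:R by exact: nbhs_infty_ger.
apply: filterS => n An.
have := d_max (u_ n) (v_ n) (v_ n) s (Du n) (Dv n) (Dv n) s01.
rewrite distxx// (max_idPl (dist_ge0 (Du n) (Dv n))) -/(q_ n).
by have := dist_triangle Dw (Dq n) (Dv n); have := far n; lra.
Qed.

End topology.

(** The point is [gamma (a + r)]. As $b-a$ differs from $d(p,q)$ by at most $\kappa$, the parameter
    stays in $[a,b]$, and the distance to $q$ costs a second $\kappa$. *)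
Lemma quasi_geodesic_point kappa p q r :
  quasi_geodesic D d kappa -> D p -> D q -> 0 <= r -> r <= d p q - kappa ->
  exists z, [/\ D z, d z p <= r + kappa & d z q + r <= d p q + 2 * kappa].
Proof.
move=> qgeo Dp Dq r0 r_le.
have [a [b [gamma [ab _ Dg [ga gb] gd]]]] := qgeo p q Dp Dq.
have Ia : a \in `[a, b] by rewrite in_itv/= lexx ab.
have Ib : b \in `[a, b] by rewrite in_itv/= lexx ab.
have [ab_le ab_ge] := gd _ _ Ia Ib.
have nab : `|a - b| = b - a by rewrite ler0_norm; lra.
move: ab_le ab_ge; rewrite nab ga gb => ab_le ab_ge.
have Iz : a + r \in `[a, b] by rewrite in_itv/=; lra.
exists (gamma (a + r)); split; first exact: Dg.
  have [_] := gd _ _ Iz Ia.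
  by rewrite ga (_ : a + r - a = r) ?ger0_norm//; lra.
have [_] := gd _ _ Iz Ib.
by rewrite gb (_ : `|a + r - b| = b - a - r) ?ler0_norm//; lra.
Qed.

End metric_on_domain.

(** * Orbits of a nonexpansive semigroup *)

Section semigroup.
Context {R : realType} {V : normedModType R} {D : set V} {d : V -> V -> R}
  {f : R -> V -> V}.
Hypothesis d_metric : is_metric_on D d.
Hypothesis d_topology : same_topology D d.
Hypothesis f_semigroup : continuous_semigroup D f.
Hypothesis f_nonexpansive : forall t, 0 <= t -> nonexpansive D d (f t).

Lemma semigroup_stable t x : 0 <= t -> D x -> D (f t x).
Proof. by case: f_semigroup => + _ _; apply. Qed.

Lemma semigroupD s t x : 0 <= s -> 0 <= t -> D x -> f (s + t) x = f t (f s x).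
Proof. by case: f_semigroup => _ + _; apply. Qed.

Lemma dist_semigroupD s t x : 0 <= s -> 0 <= t -> D x ->
  d x (f (s + t) x) <= d x (f s x) + d x (f t x).
Proof.
move=> s0 t0 Dx; rewrite addrC semigroupD//.
have [Ds Dt] := (semigroup_stable s0 Dx, semigroup_stable t0 Dx).
have := dist_triangle d_metric Dx Ds (semigroup_stable s0 Dt).
by have := f_nonexpansive s0 Dx Dt; lra.
Qed.

(** Continuity at $0^+$ bounds the displacement by 1 on some $[0,e]$; its subadditivity then bounds
    it by $n$ on $[0,ne]$. *)
Lemma orbit_locally_bounded x T : D x ->
  exists C, forall t, 0 <= t <= T -> d x (f t x) <= C.
Proof.
move=> Dx.
have [f0 fcvg] : f 0 x = x /\ f t x @[t --> 0^'+] --> x.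
  by case: f_semigroup => _ _; apply.
have [e e0 near1] : exists2 e, 0 < e & forall t, 0 <= t <= e -> d x (f t x) <= 1.
  have := fcvg _ (near_dist_lt d_metric d_topology Dx ltr01).
  rewrite near_simpl => -[e /= e0 near1]; exists (e / 2); first lra.
  move=> t /andP[]; rewrite le_eqVlt => /orP[/eqP <- _|t0 te].
    by rewrite f0 (distxx d_metric).
  apply/ltW/near1 => //; last by apply: semigroup_stable => //; exact: ltW.
  by rewrite /= sub0r normrN gtr0_norm//; lra.
have multiple n t : 0 <= t <= n%:R * e -> d x (f t x) <= n%:R.
  elim: n t => [|n IH] t.
    rewrite mul0r => /andP[t0 t0']; have -> : t = 0 by lra.
    by rewrite f0 (distxx d_metric).
  rewrite -natr1 mulrDl mul1r => /andP[t0 te].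
  have [tn|nt] := leP t (n%:R * e).
    by have := IH t; rewrite t0 tn => /(_ isT); lra.
  have ne0 : 0 <= n%:R * e by rewrite mulr_ge0// ltW.
  have -> : t = n%:R * e + (t - n%:R * e) by lra.
  have te0 : 0 <= t - n%:R * e by lra.
  have := dist_semigroupD ne0 te0 Dx.
  have := IH (n%:R * e); rewrite ne0 lexx => /(_ isT).
  have := near1 (t - n%:R * e); rewrite te0/= => h; have {}h := h ltac:(lra).
  by lra.
exists (Num.bound (T / e))%:R => t /andP[t0 tT]; apply: multiple.
rewrite t0/= (le_trans tT)// -ler_pdivrMr// ltW//.
exact: unstable.ltr_bound.
Qed.

(* Calka's theorem.  If the visits of the orbit of x to the unit ball around p
   had arbitrarily long gaps, then a limit of the visits a_N preceding the gaps
   would give one visit k close to all later a_N, and a return of k after time m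
   would force a return of a_N after time m, inside the gap. *)
Lemma orbit_no_interior_limit t0 (x p : V) (tau_ : nat -> R) :
  axiom1' D d -> 0 <= t0 -> compact_map D (f t0) ->
  without_bounded_orbits D d f ->
  D x -> (forall n, 0 <= tau_ n) -> tau_ @ \oo --> +oo ->
  f (tau_ n) x @[n --> \oo] --> p -> ~ D p.
Proof.
move=> [_ escape] t0_ge0 f_compact f_unbounded Dx tau0 /cvgryPge tauy taup Dp.
have Df t : 0 <= t -> D (f t x) by move=> t_ge0; exact: semigroup_stable.
have visits T e : 0 < e -> exists t, [/\ 0 <= t, T <= t & d (f t x) p < e].
  move=> e0.
  have near_p := cvg_dist_lt d_metric d_topology Dp (fun n => Df _ (tau0 n)) taup e0.
  near \oo => n; exists (tau_ n); split=> //; first by near: n; exact: tauy.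
  by rewrite (distC d_metric) //; [near: n|exact: Df].
(* Visits before time [t0] are dropped so that every visited point lies in the image of [f t0],
   where compactness applies. *)
pose A := [set t | t0 <= t /\ d (f t x) p < 1].
have A0 t : A t -> 0 <= t by case=> /(le_trans t0_ge0).
have [N gaps] : exists N, forall a, A a -> exists2 m, 1 <= m <= N & A (a + m).
  apply: contrapT => /forallNP no_bound.
  have /choice[a_ aP] (n : nat) :
      exists a, A a /\ forall m, 1 <= m <= n%:R -> ~ A (a + m).
    have /existsNP[a /not_implyP[Aa gap]] := no_bound n%:R.
    by exists a; split=> // m mn Aam; apply: gap; exists m.
  have Da n : D (f (a_ n) x) by apply: Df; exact: A0 (aP n).1.
  have [q [phi [phi_ge phiq]]] : exists (q : V) (phi : nat -> nat),
      (forall n, (n <= phi n)%N) /\ f (a_ (phi n)) x @[n --> \oo] --> q.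
    apply: (compact_subsequence (x_ := fun n => f (a_ n) x) f_compact) => n.
    apply: subset_closure; have [[ta _] _] := aP n.
    exists (f (a_ n - t0) x); first by apply: Df; lra.
    by rewrite -semigroupD ?subrK//; lra.
  (* The visits stay within 1 of [p], whereas by Axiom 1' a boundary limit would send them to
     infinity. *)
  have Dq : D q.
    apply: contrapT => nDq.
    have : d (f (a_ (phi n)) x) p @[n --> \oo] --> +oo.
      apply: (escape p _ q) => //; split=> //.
      exact: closure_lim phiq.
    move=> /cvgryPge /(_ 1) [n _ /(_ n (leqnn n))] /=.
    by have [[_ ?] _] := aP (phi n); lra.
  (* Three errors below 1/4 will add up: two from the visits close to [q], one from the return at
     time [tau]. *)
  have e0 : 0 < 4^-1 :> R by lra.
  have [n0 _ nearq] :=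
    cvg_dist_lt d_metric d_topology Dq (fun n => Da (phi n)) phiq e0.
  pose k := a_ (phi n0).
  have k0 : 0 <= k by exact: A0 (aP _).1.
  have [tau [tau_ge0 k_tau tau_p]] := visits (k + 1) _ e0.
  have [n [n_ge m_n]] : exists n, (n0 <= n)%N /\ tau - k <= n%:R.
    exists (maxn n0 (Num.bound (tau - k))); split; first exact: leq_maxl.
    by rewrite (le_trans (ltW (unstable.ltr_bound _)))// ler_nat leq_maxr.
  have [[ta _] gap] := aP (phi n).
  have an0 := A0 _ (aP (phi n)).1.
  have m_ge0 : 0 <= tau - k by lra.
  apply: (gap (tau - k)).
    apply/andP; split; first lra.
    by rewrite (le_trans m_n)// ler_nat.
  split; first lra.
  rewrite semigroupD//.
  have Dk := Da (phi n0); have Dn := Da (phi n).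
  have -> : 1 = 4^-1 + 4^-1 + 4^-1 + 4^-1 :> R by lra.
  have := f_nonexpansive m_ge0 Dn Dk.
  rewrite -/k -(semigroupD k0 m_ge0 Dx) (_ : k + (tau - k) = tau); last lra.
  have := dist_triangle d_metric (semigroup_stable m_ge0 Dn) (Df _ tau_ge0) Dp.
  have := dist_triangle d_metric Dn Dq Dk.
  have := nearq n0 (leqnn n0); have := nearq n n_ge; rewrite /= -/k.
  by rewrite (distC d_metric Dn Dq) -/k; lra.
have [a0 [a0_ge0 a0_t0 a0_p]] := visits t0 _ ltr01.
have Aa0 : A a0 by [].
(* Every time after [a0] is at most [N] later than some visit. The induction advances by 1, which
   the bound [1 <= m] on each jump matches. *)
have reach n t : a0 <= t <= a0 + n%:R -> exists2 a, A a & a <= t <= a + N.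
  elim: n t => [|n IH] t.
    rewrite addr0 => /andP[? ?]; exists a0 => //.
    by have [m /andP[? ?] _] := gaps _ Aa0; lra.
  rewrite -natr1 => /andP[a0t tn].
  have [tn'|nt] := leP t (a0 + n%:R); first by apply: IH; rewrite a0t.
  have an : a0 <= a0 + n%:R by rewrite lerDl.
  have [a Aa /andP[a_le a_ge]] := IH (a0 + n%:R) ltac:(by rewrite an lexx).
  have [taN|aNt] := leP t (a + N); first by exists a => //; lra.
  have [m /andP[m1 mN] Aam] := gaps _ Aa.
  by exists (a + m) => //; lra.
have [C0 C0P] := orbit_locally_bounded a0 Dx.
have [C1 C1P] := orbit_locally_bounded N Dp.
(* [C0] covers the times up to [a0]. Later, [f t x] with a visit [a] shortly before [t] is within 1
   of [f (t - a) p], which [C1] controls. *)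
apply: (f_unbounded x Dx); exists p, (d p x + `|C0| + 1 + `|C1|); split=> //.
move=> _ [t /= t_ge0 <-].
have [C0n C1n] := (ler_norm C0, ler_norm C1).
have [ta0|a0t] := leP t a0.
  have := dist_triangle d_metric Dp Dx (Df _ t_ge0).
  have := C0P t; rewrite t_ge0 ta0 => /(_ isT).
  by have := normr_ge0 C1; lra.
have [a Aa /andP[a_le t_le]] := reach (Num.bound (t - a0)) t
  ltac:(by rewrite ltW// -lerBlDl ltW// unstable.ltr_bound).
have a_ge0 := A0 _ Aa.
have ta_ge0 : 0 <= t - a by lra.
have := C1P (t - a); rewrite ta_ge0/= => h; have {}h := h ltac:(lra).
have := f_nonexpansive ta_ge0 Dp (Df _ a_ge0).
rewrite -semigroupD// (_ : a + (t - a) = t); last lra.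
have := dist_triangle d_metric Dp (semigroup_stable ta_ge0 Dp) (Df _ t_ge0).
have := dist_ge0 d_metric Dp Dx; have := normr_ge0 C0.
by case: Aa => _; rewrite (distC d_metric (Df _ a_ge0) Dp); lra.
Unshelve. all: by end_near. Qed.

(** Choose [s] almost attaining the supremum of the displacement over $[0,t]$, where the
    displacement at $t$ exceeds $B+1$. The value at [s] then exceeds $B$, and since $B$ dominates
    the displacement on $[0,T]$, [s] lies beyond [T]. *)
Lemma near_record_time y M T : without_bounded_orbits D d f -> D y ->
  exists t, [/\ 0 <= t, T <= t, M <= d y (f t y) &
    forall s, 0 <= s <= t -> d y (f s y) <= d y (f t y) + 1].
Proof.
move=> f_unbounded Dy.
have [C CP] := orbit_locally_bounded T Dy.
pose B := Num.max M C.
have [t [t0 tB]] : exists t, 0 <= t /\ B + 1 < d y (f t y).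
  apply: contrapT => /forallNP bounded; apply: (f_unbounded y Dy).
  exists y, (B + 1); split=> // _ [t /= t0 <-]; rewrite leNgt; apply/negP => h.
  by apply: (bounded t).
pose E := [set d y (f s y) | s in [set s | 0 <= s <= t]].
have Et : E (d y (f t y)) by exists t; rewrite //= t0 lexx.
have supE : has_sup E.
  split; first by exists (d y (f t y)).
  by have [C' C'P] := orbit_locally_bounded t Dy; exists C' => _ [s /= /C'P ? <-].
have [_ [s /= /andP[s0 st] <-] near_sup] := sup_adherent ltr01 supE.
have below r : 0 <= r <= t -> d y (f r y) <= sup E.
  by move=> rt; apply: (sup_upper_bound supE); exists r.
have := below t; rewrite t0 lexx => /(_ isT) t_sup.
have [BM BC] : M <= B /\ C <= B by rewrite /B !le_max !lexx orbT.
exists s; split=> //; last 2 first.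
- by lra.
- move=> r /andP[r0 rs]; have := below r; rewrite r0 (le_trans rs st) => /(_ isT).
  by lra.
rewrite leNgt; apply/negP => sT.
by have := CP s; rewrite s0 (ltW sT) => /(_ isT); lra.
Qed.

End semigroup.

(** * The boundary point [xi] and the chain from [zeta] through [eta] to [xi] *)

Theorem theorem5p3 (R : realType) (V : completeNormedModType R) (D : set V)
    (d : V -> V -> R) (kappa : R) (f : R -> V -> V)
    (D_domain : is_domain D) (D_convex : convex_set D)
    (D_bounded : bounded_set D)
    (d_metric : is_metric_on D d)
    (kappa_ge0 : 0 <= kappa) (d_qgeo : quasi_geodesic D d kappa)
    (d_topology : same_topology D d)
    (d_axiom1' : axiom1' D d) (d_axiom5' : axiom5' D d)
    (d_max_convex : max_convex D d)
    (f_semigroup : continuous_semigroup D f)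
    (f_nonexpansive : forall t, 0 <= t -> nonexpansive D d (f t))
    (f_unbounded : without_bounded_orbits D d f)
    (f_compact : exists2 t0, 0 < t0 & compact_map D (f t0)) :
  exists2 xi, norm_boundary D xi & attractor D f `<=` ch_set D (ch D xi).
Proof.
have [_ [y Dy] _] := D_domain.
have [t0 /ltW t0_ge0 ft0_compact] := f_compact.
have Df t x : 0 <= t -> D x -> D (f t x) by case: f_semigroup => + _ _; apply.
have fD s t x : 0 <= s -> 0 <= t -> D x -> f (s + t) x = f t (f s x).
  by case: f_semigroup => _ + _; apply.
have f_split t x : t0 <= t -> D x -> f t x = f t0 (f (t - t0) x).
  by move=> t0t Dx; rewrite -fD ?subrK//; lra.
have /choice[t_ tP] (n : nat) : exists t, [/\ t0 + n%:R <= t, n%:R <= d y (f t y) &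
    forall s, 0 <= s <= t -> d y (f s y) <= d y (f t y) + 1].
  have [t [_ tn ? ?]] := near_record_time d_metric d_topology f_semigroup
    f_nonexpansive n%:R (t0 + n%:R) f_unbounded Dy.
  by exists t.
have t_ge n : t0 <= t_ n by have [tn _ _] := tP n; apply: le_trans tn; rewrite lerDl.
have t_ge0 n : 0 <= t_ n := le_trans t0_ge0 (t_ge n).
have [xi [psi [psi_ge psi_xi]]] : exists (xi : V) (psi : nat -> nat),
    (forall n, (n <= psi n)%N) /\ f (t_ (psi n)) y @[n --> \oo] --> xi.
  apply: (compact_subsequence (x_ := fun n => f (t_ n) y) ft0_compact) => n.
  apply: subset_closure.
  exists (f (t_ n - t0) y); last by rewrite -f_split.
  by apply: Df => //; rewrite subr_ge0.
pose x_ n := f (t_ (psi n)) y.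
have Dx_ n : D (x_ n) by exact: Df.
have x_ge n : n%:R <= d y (x_ n).
  by have [_ + _] := tP (psi n); apply: le_trans; rewrite ler_nat.
have xi_boundary : norm_boundary D xi.
  apply: (norm_boundary_lim d_metric d_topology Dy Dx_ psi_xi).
  apply/cvgryPge => A; have : \forall n \near \oo, A <= n%:R.
    exact: nbhs_infty_ger.
  by apply: filterS => n /le_trans; exact.
exists xi => // zeta [x Dx [zeta_closure [tau_ [tau_ge0 _ tau_y tau_zeta]]]].
pose p_ n := f (tau_ n) x.
have Dp_ n : D (p_ n) by exact: Df.
have zeta_boundary : norm_boundary D zeta.
  split=> //; exact: (orbit_no_interior_limit d_metric d_topology f_semigroup
    f_nonexpansive d_axiom1' t0_ge0 ft0_compact f_unbounded Dx tau_ge0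
    tau_y tau_zeta).
have p_y : d (p_ n) y @[n --> \oo] --> +oo.
  by apply: (d_axiom1'.2 y p_ zeta).
(* The losses: [2 * kappa] from the quasi-geodesic, [d x y] from comparing two orbits, 1 from the
   near record. *)
pose C := 2 * kappa + d x y + 1.
have /choice[jiu jiuP] (n : nat) : exists jiu : nat * nat * V,
    [/\ (n <= jiu.1.1)%N, (n <= jiu.1.2)%N, (f t0 @` D) jiu.2,
      d jiu.2 (p_ jiu.1.1) + n%:R <= d y (p_ jiu.1.1) + C &
      d jiu.2 (x_ jiu.1.2) + n%:R <= d y (x_ jiu.1.2) + C].
  (* The factor 2 pays for the walk of length [n] away from [p'] and for the margin [n] that
     [segment_boundary] asks for. *)
  have [j [nj tau_t0 p_n]] :
      exists j, [/\ (n <= j)%N, t0 <= tau_ j & 2 * n%:R <= d (p_ j) y].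
    near \oo => j; exists j; split; near: j.
    - exact: nbhs_infty_ge.
    - by move/cvgryPge: tau_y; apply.
    - by move/cvgryPge: p_y; apply.
  pose p' := f (tau_ j - t0) x.
  have Dp' : D p' by apply: Df => //; lra.
  have [i [ni tau_t x_far]] : exists i, [/\ (n <= i)%N, tau_ j <= t_ (psi i) &
      d y (p_ j) + n%:R + kappa <= d y (x_ i)].
    near \oo => i; exists i; split; first by near: i; exact: nbhs_infty_ge.
      have [tn _ _] := tP (psi i).
      apply: le_trans tn; rewrite -lerBlDl (@le_trans _ _ i%:R) ?ler_nat//.
      by near: i; exact: nbhs_infty_ger.
    apply: le_trans (x_ge i); near: i; exact: nbhs_infty_ger.
  pose x' := f (t_ (psi i) - t0) y.
  have Dx' : D x' by apply: Df => //; rewrite subr_ge0.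
  have fp' : f t0 p' = p_ j by rewrite -f_split.
  have fx' : f t0 x' = x_ i by rewrite -f_split.
  (* Cancelling the common time [tau_ j - t0] leaves [x] against the orbit of [y] at the earlier
     time [t_ (psi i) - tau_ j], where the near record applies. *)
  have px_le : d p' x' <= d x y + (d y (x_ i) + 1).
    have s_ge0 : 0 <= t_ (psi i) - tau_ j by lra.
    have tau0 : 0 <= tau_ j - t0 by lra.
    have -> : x' = f (tau_ j - t0) (f (t_ (psi i) - tau_ j) y).
      by rewrite -fD//; congr (f _ y); lra.
    have := f_nonexpansive _ tau0 _ _ Dx (Df _ _ s_ge0 Dy).
    have := dist_triangle d_metric Dx Dy (Df _ _ s_ge0 Dy).
    have [_ _ /(_ (t_ (psi i) - tau_ j))] := tP (psi i).
    rewrite s_ge0 lerBlDr lerDl tau_ge0 => /(_ isT).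
    by rewrite /p' -/(x_ i); lra.
  (* [x_far] leaves room on the quasi-geodesic for a walk of length [n]. *)
  have px_ge : n%:R <= d p' x' - kappa.
    have := f_nonexpansive _ t0_ge0 _ _ Dp' Dx'; rewrite fp' fx'.
    by have := dist_triangle d_metric Dy (Dp_ j) (Dx_ i); lra.
  have [z [Dz zp zx]] := quasi_geodesic_point d_qgeo Dp' Dx' (ler0n _ n) px_ge.
  exists (j, i, f t0 z); split=> //=; first by exists z.
    have := f_nonexpansive _ t0_ge0 _ _ Dz Dp'; rewrite fp'.
    have := dist_ge0 d_metric Dx Dy.
    by rewrite (distC d_metric Dy (Dp_ j)) /C; lra.
  have := f_nonexpansive _ t0_ge0 _ _ Dz Dx'; rewrite fx'.
  by rewrite /C; lra.
pose u_ n := (jiu n).2.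
have [eta [phi [phi_ge phi_eta]]] : exists (eta : V) (phi : nat -> nat),
    (forall n, (n <= phi n)%N) /\ u_ (phi n) @[n --> \oo] --> eta.
  apply: (compact_subsequence (x_ := u_) ft0_compact) => n.
  by apply: subset_closure; have [] := jiuP n.
have Du n : D (u_ (phi n)).
  by have [_ _ [z Dz] + _ _] := jiuP (phi n); rewrite -/(u_ _) => <-; exact: Df.
have phi_leR n : n%:R <= (phi n)%:R :> R by rewrite ler_nat.
have seg_zeta : segment eta zeta `<=` norm_boundary D.
  apply: (segment_boundary d_metric d_topology (w := y) (u_ := u_ \o phi)
    (v_ := fun n => p_ (jiu (phi n)).1.1) (C := C)) => //.
    apply: (cvg_reindex (x_ := p_)) tau_zeta => n.
    by have [/(leq_trans (phi_ge n)) ] := jiuP (phi n).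
  move=> n; have [_ _ _ + _] := jiuP (phi n); apply: le_trans.
  by rewrite lerD2l.
have seg_xi : segment eta xi `<=` norm_boundary D.
  apply: (segment_boundary d_metric d_topology (w := y) (u_ := u_ \o phi)
    (v_ := fun n => x_ (jiu (phi n)).1.2) (C := C)) => //.
    apply: (cvg_reindex (x_ := x_)) psi_xi => n.
    by have [_ /(leq_trans (phi_ge n)) ] := jiuP (phi n).
  move=> n; have [_ _ _ _] := jiuP (phi n); apply: le_trans.
  by rewrite lerD2l.
exists eta.
  split=> //; apply: seg_xi; exists 1; rewrite /= ?lexx ?ler01//.
  by rewrite subrr scale0r addr0 scale1r.
(* The segment is traversed backwards, hence the parameter [1 - s]. *)
split=> // _ [s /andP[s0 s1] <-]; apply: seg_zeta; exists (1 - s).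
  by rewrite /= subr_ge0 gerBl s0 s1.
by rewrite subKr addrC.
Unshelve. all: by end_near. Qed.
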